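(* Let $L$ be a non-negative integer, $f$ a positive integer, and for non-negative integers $n_1,\dots,n_f$ put $N_i:=n_i+n_{i+1}+\dots+n_f$ for $i=1,\dots,f$. Then \begin{align*} &\sum_{m,n,n_1,\dots,n_f\geq 0}\frac{q^{2m^2+6mn+6n^2+m+3n+N_1^2+\dots+N_f^2}(q;q)_{2L}(q;q)_{n_f}}{(q;q)_m(q^3;q^3)_n(q;q)_{L-N_1}(q;q)_{n_f-3n-2m}(q;q)_{n_1}\cdots(q;q)_{n_{f-1}}(q;q)_{2n_f}}\\ &\quad+q\sum_{m,n,n_1,\dots,n_f\geq 0}\frac{q^{2m^2+6mn+6n^2+3m+6n+N_1^2+\dots+N_f^2}(q;q)_{2L}(q;q)_{n_f}}{(q;q)_m(q^3;q^3)_n(q;q)_{L-N_1}(q;q)_{n_f-3n-2m-1}(q;q)_{n_1}\cdots(q;q)_{n_{f-1}}(q;q)_{2n_f}} =\sum_{j=-L}^{L}\left(\frac{j+1}{3}\right)q^{(f+1)j^2+j}{2L\brack L-j}_q. \end{align*}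
   Context: $(a;p)_n=\prod_{k=0}^{n-1}(1-ap^k)$ for a base $p$. By convention $1/(q;q)_n=0$ for negative integers $n$, so summands with a negative index in a denominator vanish. The $q$-binomial coefficient is ${m+n\brack m}_q=\frac{(q;q)_{m+n}}{(q;q)_m(q;q)_n}$ for $m,n\ge0$ and $0$ otherwise. $\left(\frac{a}{3}\right)$ denotes the Jacobi symbol modulo 3: $0$ if $3\mid a$, $1$ if $a\equiv1\pmod 3$, $-1$ if $a\equiv 2\pmod 3$. *)

(* Defs.v *)
From HB Require Import structures.
From mathcomp Require Import all_boot all_order all_algebra.
From mathcomp Require Import boolp classical_sets cardinality fsbigop.

Set Implicit Arguments.
Unset Strict Implicit.
Unset Printing Implicit Defensive.

Import Order.TTheory GRing.Theory Num.Theory.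
Local Open Scope ring_scope.

Section QSeries.
Variable F : fieldType.

Definition qpoch (a p : F) (n : nat) : F := \prod_(k < n) (1 - a * p ^+ k).

(* 1 / (p;p)_n for an integer n, with the convention that it is 0 for n < 0 *)
Definition rqpoch (p : F) (n : int) : F :=
  match n with
  | Posz k => (qpoch p p k)^-1
  | Negz _ => 0
  end.

(* [M over k]_q; with M = m + n and k = m it is nonzero only if m, n >= 0 *)
Definition qbinom (q : F) (M k : int) : F :=
  match k, M - k with
  | Posz m, Posz n => qpoch q q (m + n) / (qpoch q q m * qpoch q q n)
  | _, _ => 0
  end.

End QSeries.

Definition jacobi3 (a : int) : int :=
  if (a %% 3)%Z == 0 then 0 else if (a %% 3)%Z == 1 then 1 else -1.

(* The indices n_1, ..., n_f are stored in a tuple; i is 1-based, and only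
   1 <= i <= f is meaningful. *)
Definition part (f : nat) (s : f.-tuple nat) (i : nat) : nat := nth 0%N s i.-1.

(* N_i = n_i + n_(i+1) + ... + n_f *)
Definition tailsum (f : nat) (s : f.-tuple nat) (i : nat) : nat :=
  (\sum_(i <= k < f.+1) part s k)%N.

Definition sqsum (f : nat) (s : f.-tuple nat) : nat :=
  (\sum_(1 <= i < f.+1) tailsum s i ^ 2)%N.

Section Summands.
Variables (F : fieldType) (q : F) (L f : nat).

Definition summand1 (m n : nat) (s : f.-tuple nat) : F :=
  q ^+ (2 * m ^ 2 + 6 * m * n + 6 * n ^ 2 + m + 3 * n + sqsum s)
  * qpoch q q (2 * L) * qpoch q q (part s f)
  * (rqpoch q m * rqpoch (q ^+ 3) n
     * rqpoch q (L%:Z - (tailsum s 1)%:Z)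
     * rqpoch q ((part s f)%:Z - (3 * n)%:Z - (2 * m)%:Z)
     * (\prod_(1 <= i < f) rqpoch q (part s i))
     * rqpoch q (2 * part s f)%N).

Definition summand2 (m n : nat) (s : f.-tuple nat) : F :=
  q ^+ (2 * m ^ 2 + 6 * m * n + 6 * n ^ 2 + 3 * m + 6 * n + sqsum s)
  * qpoch q q (2 * L) * qpoch q q (part s f)
  * (rqpoch q m * rqpoch (q ^+ 3) n
     * rqpoch q (L%:Z - (tailsum s 1)%:Z)
     * rqpoch q ((part s f)%:Z - (3 * n)%:Z - (2 * m)%:Z - 1)
     * (\prod_(1 <= i < f) rqpoch q (part s i))
     * rqpoch q (2 * part s f)%N).

End Summands.

(* Main.v *)
Require Import Defs.
From HB Require Import structures.
From mathcomp Require Import all_boot all_order all_algebra.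
From mathcomp Require Import boolp classical_sets cardinality fsbigop.
From mathcomp Require Import ring zify.

Set Implicit Arguments.
Unset Strict Implicit.
Unset Printing Implicit Defensive.

Import Order.TTheory GRing.Theory Num.Theory.
Local Open Scope classical_set_scope.
Local Open Scope ring_scope.

(* Bailey's lemma (q-Vandermonde summation) turns
   A(r) = \sum_j a_j [2r, r-j] into
   \sum_R q^(R^2) (q)_(2L) / ((q)_(L-R) (q)_(2R)) A(R)
     = \sum_j a_j q^(j^2) [2L, L-j].
   Iterating it f times with R = N_1, ..., N_f reduces the theorem to the
   identity for f = 0, whose left side, with M = 2m + 3n, is
   A(r) = \sum_(m, n) q^(3n(n+1)/2) / ((q)_m (q^3;q^3)_n) (u_M + u_(M+1)),
   u_M = q^(M(M+1)/2) (q)_r / (q)_(r-M).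
   Both sides of that identity satisfy
   A(r+2) = (1 + q - q^(2r+4)) A(r+1) - q (1-q^(2r+2)) (1-q^(2r+3)) A(r):
   the left side because the generating function
   (1+x) (-x^3q^3;q^3)_oo / (x^2;q)_oo of the coefficients of u_M satisfies a
   third order q-difference equation, the right side termwise once j and
   -j-2 are paired. *)

(** * q-Factorials and their reciprocals *)

Section QFactorial.
Variables (F : fieldType) (q : F).
Hypothesis hq : forall n : nat, (0 < n)%N -> q ^+ n != 1.

Local Notation P := (qpoch q q).

(** Stands for 1/(q)_(n-m). The test supplies the convention 0 for m > n, where truncated
    subtraction would give 1/(q)_0 = 1. *)
Definition rfact (n m : nat) : F := if (m <= n)%N then (P (n - m))^-1 else 0.

Lemma rqpochB (n m : nat) : rqpoch q (n%:Z - m%:Z) = rfact n m.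
Proof.
rewrite /rfact; case: leqP => [le_mn|lt_nm]; first by rewrite subzn.
by rewrite (_ : n%:Z - m%:Z = Negz (m - n).-1) //; lia.
Qed.

Lemma rfact_small (n m : nat) : (n < m)%N -> rfact n m = 0.
Proof. by rewrite /rfact ltnNge => /negbTE ->. Qed.

Lemma rfactE (k n m : nat) : n = (m + k)%N -> rfact n m = (P k)^-1.
Proof. by move=> ->; rewrite /rfact leq_addr addKn. Qed.

Lemma qpoch0 (a p : F) : qpoch a p 0 = 1.
Proof. exact: big_ord0. Qed.

Lemma qpochS (a p : F) (n : nat) :
  qpoch a p n.+1 = qpoch a p n * (1 - a * p ^+ n).
Proof. exact: big_ord_recr. Qed.

Lemma qfact_neq0 (n : nat) : P n != 0.
Proof. by apply/prodf_neq0 => i _; rewrite -exprS subr_eq0 eq_sym hq. Qed.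

(** Oriented towards the larger index, so that reciprocals become multiples of a single one and
    [ring] can conclude. *)
Lemma qfactV (n : nat) : (P n)^-1 = (1 - q ^+ n.+1) * (P n.+1)^-1.
Proof.
have := qfact_neq0 n.+1; rewrite qpochS -exprS mulf_eq0 => /norP[nz nz'].
by rewrite invfM [in RHS]mulrC mulfVK.
Qed.

Let expE := (mulnDr, mulnDl, mulnS, mulSn, mul2n, =^~ addnn, exprD, exprS).

(** * Recurrences of the summands at f = 0, and the q-Vandermonde sum *)

Fixpoint tri (n : nat) : nat := if n is k.+1 then (n + tri k)%N else 0%N.

Definition seed_term (r M : nat) : F := q ^+ tri M * P r * rfact r M.

(* The telescoping certificate; with d_M the coefficient of x^M in the
   generating function above, dividing the q-difference equation for
   \sum_M q^(M(M+1)/2) d_M y^M by (q^2 y; q)_oo yields it as a coefficient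
   of y^(r+2). *)
Definition seed_cert (r M : nat) : F :=
  - (q ^+ (tri M + 2 * (r.+2 - M)) * P r.+1 * rfact r.+2 M).

(** The right side is built so that the instances at M and M+1 add up to the operator of
    [seed_adjoint] applied to [seed_cert r]: the terms at M+1 cancel. *)
Lemma seed_term_rec (r M : nat) :
  seed_term r.+2 M - (1 + q - q ^+ (2 * r + 4)) * seed_term r.+1 M
    + q * (1 - q ^+ (2 * r + 2)) * (1 - q ^+ (2 * r + 3)) * seed_term r M
  = (q ^+ M - 1) * seed_cert r M - (q ^+ M.+1 - 1) * seed_cert r M.+1
    + (q ^+ M.+2 + q) * seed_cert r M.+2 - q * seed_cert r M.+3.
Proof.
rewrite /seed_term /seed_cert.
case: (ltnP r.+2 M) => [lt|le].
  by rewrite !rfact_small; [ring | lia ..].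
have [k Ek] : exists k, r.+2 = (M + k)%N by exists (r.+2 - M)%N; lia.
(* Here k = r+2-M. For k < 3 some reciprocals vanish; from k = 3 on all of them are multiples of
   1/(q)_(r+2-M). *)
case: k Ek => [|[|[|k]]] Ek.
- rewrite (_ : M = r.+2); last by lia.
  rewrite (@rfactE 0 r.+2 r.+2) ?addn0 // !rfact_small; try lia.
  rewrite subnn !qpochS /=  !expE !expr0.
  ring.
- rewrite (_ : M = r.+1); last by lia.
  rewrite (@rfactE 1 r.+2 r.+1) ?(@rfactE 0 r.+1 r.+1) ?(@rfactE 0 r.+2 r.+2); try lia.
  rewrite !rfact_small; try lia.
  rewrite subSnn subnn (qfactV 0) !qpochS /= !expE !expr0.
  ring.
- rewrite (_ : M = r); last by lia.
  rewrite (@rfactE 2 r.+2 r) ?(@rfactE 1 r.+2 r.+1) ?(@rfactE 0 r.+2 r.+2)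
    ?(@rfactE 1 r.+1 r) ?(@rfactE 0 r r); try lia.
  rewrite !rfact_small; try lia.
  rewrite subSnn subnn (_ : r.+2 - r = 2)%N; last by lia.
  rewrite (qfactV 0) (qfactV 1) !(qpochS _ _ r.+1) !(qpochS _ _ r) /= !expE !expr0.
  ring.
- have -> : r = (M + k).+1 by lia.
  rewrite (@rfactE k.+3 (M + k).+3 M) ?(@rfactE k.+2 (M + k).+2 M)
    ?(@rfactE k.+1 (M + k).+1 M) ?(@rfactE k.+2 _ M.+1)
    ?(@rfactE k.+1 _ M.+2) ?(@rfactE k _ M.+3); try lia.
  rewrite (_ : (M + k).+3 - M = k + 3)%N; last by lia.
  rewrite (_ : (M + k).+3 - M.+1 = k + 2)%N; last by lia.
  rewrite (_ : (M + k).+3 - M.+2 = k + 1)%N; last by lia.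
  rewrite (_ : (M + k).+3 - M.+3 = k)%N; last by lia.
  rewrite (qfactV k) (qfactV k.+1) (qfactV k.+2) !(qpochS _ _ (M + k).+2)
   !(qpochS _ _ (M + k).+1) /= !expE !expr0.
  ring.
Qed.


(* The binomial [2r, r-j] q^(j^2+j) at j = i-1 minus the one at j = -i-1. *)
Definition paired_term (r i : nat) : F :=
  q ^+ (i * i.-1) * (1 - q ^+ (2 * i)) * P (2 * r).+1 * rfact r.+1 i
  * (P (r + i).+1)^-1.

Lemma paired_term0 (r : nat) : paired_term r 0 = 0.
Proof. by rewrite /paired_term muln0 expr0 subrr mulr0 !mul0r. Qed.

Lemma paired_term_small (r i : nat) : (r.+1 < i)%N -> paired_term r i = 0.
Proof. by move=> lt; rewrite /paired_term rfact_small // mulr0 mul0r. Qed.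

(** Instead of the factor -q^(2r+4) on the middle term, q^(2r+4) multiplies its two neighbours in i.
    Summation against the symbol, whose values at three consecutive integers add to 0, turns one
    form into the other. *)
Lemma paired_term_rec (r i : nat) :
  paired_term r.+2 i.+1 = (1 + q) * paired_term r.+1 i.+1
    + q ^+ (2 * r + 4) * (paired_term r.+1 i + paired_term r.+1 i.+2)
    - q * (1 - q ^+ (2 * r + 2)) * (1 - q ^+ (2 * r + 3)) * paired_term r i.+1.
Proof.
case: (ltnP r.+2 i) => [lt|le].
  by rewrite !paired_term_small; [ring | lia ..].
have [k Ek] : exists k, r.+2 = (i + k)%N by exists (r.+2 - i)%N; lia.
(* All terms are brought to the common factor (q)_(2r+3): here it absorbs two factors, next it is
   split off from (q)_(2r+5). *)
have -> : q * (1 - q ^+ (2 * r + 2)) * (1 - q ^+ (2 * r + 3)) * paired_term r i.+1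
    = q * (q ^+ (i.+1 * i) * (1 - q ^+ (2 * i.+1)) * P (2 * r).+3
           * rfact r.+1 i.+1 * (P (r + i).+2)^-1).
  rewrite /paired_term addnS [in RHS]qpochS [in RHS]qpochS -!exprS !addnS addn0 /=.
  by ring.
have -> : paired_term r.+2 i.+1
    = q ^+ (i.+1 * i) * (1 - q ^+ (2 * i.+1)) * (P (2 * r).+3
           * (1 - q ^+ (2 * r + 4)) * (1 - q ^+ (2 * r + 5)))
           * rfact r.+3 i.+1 * (P (r + i).+4)^-1.
  rewrite /paired_term (_ : (2 * r.+2).+1 = (2 * r).+4.+1); last by lia.
  rewrite [in LHS]qpochS [in LHS]qpochS -!exprS !addnS addn0 addSn.
  by congr (_ * _).
rewrite /paired_term (_ : (2 * r.+1).+1 = (2 * r).+3); last by lia.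
rewrite !(addSn, addnS) /= (qfactV (r + i).+2) (qfactV (r + i).+3) addn0.
rewrite (_ : i.+2 * i.+1 = i * i.-1 + i + i + i + i + 2)%N; last by case: (i); lia.
rewrite (_ : i.+1 * i = i * i.-1 + i + i)%N; last by case: (i); lia.
move: (P _.+3) (P _.+4)^-1 (i * i.-1)%N => C D e.
case: k Ek => [|[|k]] Ek.
- rewrite (_ : i = r.+2); last by lia.
  rewrite (@rfactE 0 r.+3 r.+3) ?(@rfactE 0 r.+2 r.+2); try lia.
  rewrite !rfact_small; try lia.
  rewrite /= !expE !expr0.
  move: (_^-1) (q ^+ r) (q ^+ e) => E X Z.
  by ring.
- rewrite (_ : i = r.+1); last by lia.
  rewrite (@rfactE 1 r.+3 r.+2) ?(@rfactE 0 r.+2 r.+2) ?(@rfactE 1 r.+2 r.+1); try lia.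
  rewrite !rfact_small; try lia.
  rewrite (qfactV 0) /= !expE !expr0.
  move: (_^-1) (q ^+ r) (q ^+ e) => E X Z.
  by ring.
- rewrite (_ : r = (i + k)%N); last by lia.
  rewrite (@rfactE k.+2 (i + k).+3 i.+1) ?(@rfactE k.+1 (i + k).+2 i.+1)
    ?(@rfactE k.+2 (i + k).+2 i) ?(@rfactE k (i + k).+1 i.+1)
    ?(@rfactE k (i + k).+2 i.+2); try lia.
  rewrite (qfactV k) (qfactV k.+1) /= !expE !expr0.
  move: (_^-1) (q ^+ i) (q ^+ k) (q ^+ e) => E X Y Z.
  by ring.
Qed.

(** Multiply by 1-q^(K+1) = (1-q^(K+1-s)) + q^(K+1-s) (1-q^s). The first part lowers K+1-s, the
    second shifts s, and the induction hypothesis applies at B and at B+1. *)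
Lemma qvandermonde (K B : nat) :
  \sum_(s < K.+1) q ^+ (s * (s + B)) * (P (K - s))^-1 * (P s)^-1 * (P (s + B))^-1
  = (P K)^-1 * (P (K + B))^-1.
Proof.
elim: K B => [|K IH] B.
  by rewrite big_ord1 /= qpoch0 invr1 !mul1r add0n.
have nz : 1 - q ^+ K.+1 != 0 by rewrite subr_eq0 eq_sym hq.
apply: (mulfI nz); rewrite mulrA -qfactV.
transitivity ((P K)^-1 * (P (K + B))^-1
    + q ^+ (K + B).+1 * ((P K)^-1 * (P (K + B.+1))^-1)); last first.
  by rewrite (qfactV (K + B)) addnS addSn; ring.
rewrite -!IH !mulr_sumr.
transitivity (\sum_(s < K.+2) (q ^+ (s * (s + B)) * (1 - q ^+ (K.+1 - s))
     * (P (K.+1 - s))^-1 * (P s)^-1 * (P (s + B))^-1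
   + q ^+ (s * (s + B)) * (q ^+ (K.+1 - s) * (1 - q ^+ s))
     * (P (K.+1 - s))^-1 * (P s)^-1 * (P (s + B))^-1)).
  apply: eq_bigr => s _.
  have -> : q ^+ K.+1 = q ^+ (K.+1 - s) * q ^+ s.
    by rewrite -exprD subnK // -ltnS.
  ring.
rewrite big_split /=; congr (_ + _).
- rewrite big_ord_recr /= subnn expr0 subrr mulr0 !mul0r addr0.
  apply: eq_bigr => s _; rewrite subSn; last by rewrite -ltnS.
  by rewrite (qfactV (K - s)); ring.
- rewrite big_ord_recl /= expr0 subrr !mulr0 !mul0r add0r.
  apply: eq_bigr => s _.
  rewrite /bump /= add1n subSS (qfactV s) addSnnS.
  have -> : q ^+ (K + B).+1 = q ^+ (s + B.+1) * q ^+ (K - s).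
    by rewrite -exprD; congr (_ ^+ _); have := ltn_ord s; lia.
  by rewrite mulSn exprD; ring.
Qed.

(** The shift R = j+s gives [qvandermonde] with parameters L-j and 2j. Terms with R < j or R > L
    vanish, so K is only a cutoff. *)
Lemma qvandermonde_rfact (K L j : nat) : (L < K)%N ->
  \sum_(R < K) q ^+ (R ^ 2) * rfact L R * (rfact R j * (P (R + j))^-1)
  = q ^+ (j ^ 2) * (rfact L j * (P (L + j))^-1).
Proof.
move=> ltLK; case: (ltnP L j) => [ltLj|lejL].
  rewrite (rfact_small ltLj) mul0r mulr0 big1 // => R _.
  case: (ltnP L R) => [ltLR|leRL]; first by rewrite (rfact_small ltLR) mulr0 mul0r.
  by rewrite (@rfact_small R) ?mul0r ?mulr0 //; lia.
have [k Ek] : exists k, L = (j + k)%N by exists (L - j)%N; lia.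
have [l El] : exists l, K = (j + (k.+1 + l))%N by exists (K - L.+1)%N; lia.
rewrite El big_split_ord /= big1 ?add0r => [|R _]; last first.
  by rewrite (@rfact_small R) ?mul0r ?mulr0.
rewrite big_split_ord /= [X in _ + X]big1 ?addr0 => [|R _]; last first.
  by rewrite rfact_small ?mulr0 ?mul0r //; lia.
rewrite (@rfactE k L j) // Ek.
rewrite (_ : (j + k + j = k + 2 * j)%N) -?qvandermonde ?mulr_sumr; last by lia.
apply: eq_bigr => s _; have := ltn_ord s => lts.
rewrite (@rfactE (k - s) _ (j + s)%N); last by lia.
rewrite (@rfactE s (j + s)%N j) // (_ : j + s + j = s + 2 * j)%N; last by lia.
have -> : ((j + s) ^ 2 = j ^ 2 + s * (s + 2 * j))%N by lia.
by rewrite exprD; ring.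
Qed.

End QFactorial.

(** * The symbol modulo 3 *)

Lemma int_mod3 (a : int) :
  exists k : int, [\/ a = k * 3 + 0, a = k * 3 + 1 | a = k * 3 + 2].
Proof.
exists (a %/ 3)%Z; have := divz_eq a 3; have := @modz_ge0 a 3 isT.
have := @ltz_mod a 3 isT; by case: (a %% 3)%Z => [[|[|[|c]]]|c] // _ _ ?;
  [apply: Or31 | apply: Or32 | apply: Or33].
Qed.

(** Three consecutive integers take the values 0, 1 and -1 once each. *)
Lemma jacobi3_rec (a : int) : jacobi3 (a + 2) = - jacobi3 (a + 1) - jacobi3 a.
Proof.
by have [k [] ->] := int_mod3 a; rewrite -!addrA /jacobi3 !modzMDl.
Qed.

Lemma jacobi3N (a : int) : jacobi3 (- a) = - jacobi3 a.
Proof.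
by have [k [] ->] := int_mod3 a; rewrite opprD -mulNr /jacobi3 !modzMDl.
Qed.

(** * The identity for f = 0: recurrence in r and initial values *)

Section Seed.
Variables (F : fieldType) (q : F).
Hypothesis hq : forall n : nat, (0 < n)%N -> q ^+ n != 1.

Local Notation P := (qpoch q q).

Lemma expr3_neq1 (n : nat) : (0 < n)%N -> (q ^+ 3) ^+ n != 1.
Proof. by move=> n_gt0; rewrite -exprM hq // muln_gt0. Qed.

(** For g(x) = 1/(x^2;q)_oo, the sum of x^(2m)/(q)_m, this is g(qx) = (1-x^2)(1-qx^2) g(x) tested
    against [psi], with the boundary term at K on the right. *)
Lemma telescope_qfactV (K : nat) (psi : nat -> F) :
  \sum_(m < K) (P m)^-1
    * ((q ^+ (2 * m) - 1) * psi m + (1 + q) * psi m.+1 - q * psi m.+2)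
  = (P K)^-1 * ((1 - q ^+ (2 * K)) * psi K - q * (1 - q ^+ K) * psi K.+1).
Proof.
elim: K => [|K IH]; first by rewrite big_ord0 /= !expr0 !subrr !mulr0 !mul0r subr0 mulr0.
rewrite big_ord_recr /= IH (qfactV hq K) mulnS !mul2n -!addnn !exprD !exprS.
by ring.
Qed.

(** The coefficient of x^(3n) in (-x^3q^3;q^3)_oo, by Euler's expansion. *)
Definition cube_coef (n : nat) : F :=
  q ^+ (3 * tri n) * (qpoch (q ^+ 3) (q ^+ 3) n)^-1.

(** The equation h(x) = (1+x^3q^3) h(qx) of h(x) = (-x^3q^3;q^3)_oo, tested against [chi] and cut at
    K. *)
Lemma telescope_cube_coef (K : nat) (chi : nat -> F) :
  \sum_(n < K) cube_coef n
    * ((q ^+ (3 * n) - 1) * chi n + q ^+ (3 * n + 3) * chi n.+1)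
  = cube_coef K * (1 - q ^+ (3 * K)) * chi K.
Proof.
rewrite /cube_coef.
elim: K => [|K IH]; first by rewrite big_ord0 /= !expr0 !subrr !mulr0 !mul0r.
rewrite big_ord_recr /= IH (qfactV expr3_neq1 K) -exprM.
rewrite (_ : 3 * K + 3 = 3 * K.+1)%N; last by lia.
rewrite mulnDr exprD.
by ring.
Qed.

(* The q-difference equation of (-x^3q^3;q^3)_oo / (x^2;q)_oo, tested against
   an arbitrary finitely supported phi. *)
Lemma seed_adjoint (K : nat) (phi : nat -> F) :
    (forall M, (K <= M)%N -> phi M = 0) ->
  \sum_(m < K) \sum_(n < K) cube_coef n * (P m)^-1
    * ((q ^+ (2 * m + 3 * n) - 1) * phi (2 * m + 3 * n)%N
       + (1 + q) * phi (2 * m + 3 * n).+2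
       + q ^+ (2 * m + 3 * n).+3 * phi (2 * m + 3 * n).+3
       - q * phi (2 * m + 3 * n).+4) = 0.
Proof.
move=> phi0.
(* Since q^(2m+3n)-1 = (q^(2m)-1) + q^(2m) (q^(3n)-1), the operator splits into one that telescopes
   in m and one that telescopes in n; the boundary terms vanish because [phi] is zero from K on. *)
transitivity (\sum_(m < K) \sum_(n < K) cube_coef n * ((P m)^-1
     * ((q ^+ (2 * m) - 1) * phi (2 * m + 3 * n)%N
        + (1 + q) * phi (2 * m.+1 + 3 * n)%N - q * phi (2 * m.+2 + 3 * n)%N))
  + \sum_(m < K) \sum_(n < K) (P m)^-1 * q ^+ (2 * m) * (cube_coef n
     * ((q ^+ (3 * n) - 1) * phi (2 * m + 3 * n)%N
        + q ^+ (3 * n + 3) * phi (2 * m + 3 * n.+1)%N))).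
  rewrite -big_split; apply: eq_bigr => m _.
  rewrite -big_split; apply: eq_bigr => n _ /=.
  rewrite (_ : 2 * m.+1 + 3 * n = (2 * m + 3 * n).+2)%N; last by lia.
  rewrite (_ : 2 * m.+2 + 3 * n = (2 * m + 3 * n).+4)%N; last by lia.
  rewrite (_ : 2 * m + 3 * n.+1 = (2 * m + 3 * n).+3)%N; last by lia.
  rewrite !exprS !exprD.
  by ring.
rewrite exchange_big /= !big1 ?addr0 // => i _; rewrite -mulr_sumr.
  by rewrite (telescope_cube_coef _ (fun n => phi (2 * i + 3 * n)%N)) phi0 ?mulr0 //; lia.
rewrite (telescope_qfactV _ (fun m => phi (2 * m + 3 * i)%N)) !phi0; try lia.
by rewrite !mulr0 subr0 !mulr0.
Qed.

(** A(r) of the overview at f = 0, cut at K. The cut loses nothing once r < K, since u_M = 0 for M >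
    r. *)
Definition seed (K r : nat) : F :=
  \sum_(m < K) \sum_(n < K) cube_coef n * (P m)^-1
    * (seed_term q r (2 * m + 3 * n) + seed_term q r (2 * m + 3 * n).+1).

Lemma seed_rec (K r : nat) : (r.+2 < K)%N ->
  seed K r.+2 = (1 + q - q ^+ (2 * r + 4)) * seed K r.+1
    - q * (1 - q ^+ (2 * r + 2)) * (1 - q ^+ (2 * r + 3)) * seed K r.
Proof.
move=> ltrK; apply/eqP; rewrite -subr_eq0; apply/eqP.
(* The zero on the right is replaced by the vanishing sum for [seed_cert q r], which is zero beyond
   r+2; both sides then agree summand by summand. *)
rewrite -[RHS](@seed_adjoint K (seed_cert q r)) => [|M leKM]; last first.
  by rewrite /seed_cert rfact_small ?mulr0 ?oppr0 //; lia.
rewrite opprB addrC /seed !mulr_sumr -!sumrN -!big_split /=.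
apply: eq_bigr => m _; rewrite !mulr_sumr -!sumrN -!big_split /=.
apply: eq_bigr => n _; set M := (2 * m + 3 * n)%N.
transitivity (cube_coef n * (P m)^-1 * (
    (seed_term q r.+2 M - (1 + q - q ^+ (2 * r + 4)) * seed_term q r.+1 M
    + q * (1 - q ^+ (2 * r + 2)) * (1 - q ^+ (2 * r + 3)) * seed_term q r M)
   + (seed_term q r.+2 M.+1 - (1 + q - q ^+ (2 * r + 4)) * seed_term q r.+1 M.+1
    + q * (1 - q ^+ (2 * r + 2)) * (1 - q ^+ (2 * r + 3)) * seed_term q r M.+1))).
  by ring.
by rewrite !seed_term_rec //; ring.
Qed.

(** The right side at f = 0, with j = i paired with j = -i-2, whose symbol is (-i-1|3) = -(i+1|3);
    the unpaired j = -1 has symbol 0. *)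
Definition paired_sum (K r : nat) : F :=
  \sum_(i < K) (jacobi3 i.+1)%:~R * paired_term q r i.+1.

(** In the interior, w_k is collected with coefficient (k+1|3) + (k-1|3) = -(k|3); the two terms
    outside the sum are the boundary at K. *)
Lemma jacobi3_sum (K : nat) (w : nat -> F) : w 0%N = 0 ->
  \sum_(i < K) (jacobi3 i.+1)%:~R * (w i + w i.+2)
  = (jacobi3 K)%:~R * w K.+1 - (jacobi3 K.+1)%:~R * w K
    - \sum_(i < K) (jacobi3 i.+1)%:~R * w i.+1.
Proof.
move=> w0; elim: K => [|K IH].
  by rewrite !big_ord0 w0 mulr0 mul0r !subrr.
rewrite !big_ord_recr /= IH.
have -> : jacobi3 K.+2 = - jacobi3 K.+1 - jacobi3 K.
  by rewrite -(addn2 K) PoszD jacobi3_rec -addn1 PoszD.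
by rewrite intrB mulrNz; ring.
Qed.

Lemma paired_sum_rec (K r : nat) : (r.+2 < K)%N ->
  paired_sum K r.+2 = (1 + q - q ^+ (2 * r + 4)) * paired_sum K r.+1
    - q * (1 - q ^+ (2 * r + 2)) * (1 - q ^+ (2 * r + 3)) * paired_sum K r.
Proof.
move=> ltrK.
transitivity ((1 + q) * paired_sum K r.+1 + q ^+ (2 * r + 4)
    * (\sum_(i < K) (jacobi3 i.+1)%:~R * (paired_term q r.+1 i + paired_term q r.+1 i.+2))
    - q * (1 - q ^+ (2 * r + 2)) * (1 - q ^+ (2 * r + 3)) * paired_sum K r).
  rewrite /paired_sum !mulr_sumr -!sumrN -!big_split /=; apply: eq_bigr => i _.
  by rewrite paired_term_rec //; ring.
rewrite jacobi3_sum ?paired_term0 // !(@paired_term_small _ _ r.+1); try lia.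
by rewrite !mulr0 subrr -/(paired_sum K r.+1); ring.
Qed.

(** For r <= 1 only m = n = 0 contributes, as u_M vanishes for M > r. *)
Lemma seed0 (K : nat) : (0 < K)%N -> seed K 0 = 1.
Proof.
case: K => // K _; rewrite /seed big_ord_recl [X in _ + X]big1 ?addr0; last first.
  move=> m _; rewrite big1 // => n _.
  by rewrite /seed_term !rfact_small ?mulr0 ?addr0 ?mulr0 //= /bump; lia.
rewrite big_ord_recl [X in _ + X]big1 ?addr0; last first.
  move=> n _; by rewrite /seed_term !rfact_small ?mulr0 ?addr0 ?mulr0 //= /bump; lia.
rewrite /seed_term /cube_coef /= !muln0 addn0.
rewrite (@rfact_small _ _ _ 1) // (@rfactE _ _ 0) //.
by rewrite !qpoch0 /= !expr0 !invr1 !mulr1 mulr0 addr0 mulr1.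
Qed.

Lemma seed1 (K : nat) : (1 < K)%N -> seed K 1 = 1 + q - q ^+ 2.
Proof.
case: K => // K _; rewrite /seed big_ord_recl [X in _ + X]big1 ?addr0; last first.
  move=> m _; rewrite big1 // => n _.
  by rewrite /seed_term !rfact_small ?mulr0 ?addr0 ?mulr0 //= /bump; lia.
rewrite big_ord_recl [X in _ + X]big1 ?addr0; last first.
  move=> n _; by rewrite /seed_term !rfact_small ?mulr0 ?addr0 ?mulr0 //= /bump; lia.
rewrite /seed_term /cube_coef /= !muln0 addn0 (@rfactE _ _ 0 1 1) // (@rfactE _ _ 1) //.
rewrite (qfactV hq 0) !(qpochS _ _ 0) !qpoch0 /= !expr0 !invr1.
rewrite !mulr1 !mul1r mulrV; last first.
  by rewrite unitfE subr_eq0 eq_sym -[q]expr1 hq.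
by ring.
Qed.

Lemma paired_sum0 (K : nat) : (0 < K)%N -> paired_sum K 0 = 1.
Proof.
case: K => // K _; rewrite /paired_sum big_ord_recl [X in _ + X]big1 ?addr0; last first.
  by move=> i _; rewrite paired_term_small ?mulr0 //= /bump; lia.
rewrite /paired_term (@rfactE _ _ 0) // qpoch0 /= invr1.
have := qfact_neq0 hq 2; rewrite !qpochS qpoch0 -!exprS.
rewrite (_ : jacobi3 _ = 1) // !mulf_eq0 => /norP[/norP[_ n1] n2].
by field; apply/andP; split.
Qed.

Lemma paired_sum1 (K : nat) : (1 < K)%N -> paired_sum K 1 = 1 + q - q ^+ 2.
Proof.
case: K => [|[|K]] // _.
rewrite /paired_sum !big_ord_recl [X in _ + (_ + X)]big1; last first.
  by move=> i _; rewrite paired_term_small ?mulr0 //= /bump; lia.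
rewrite /paired_term /= (@rfactE _ _ 0 2 2) // (@rfactE _ _ 1 2 1) //.
have := qfact_neq0 hq 4; rewrite !qpochS qpoch0 -!exprS.
rewrite (_ : jacobi3 1 = 1) // (_ : jacobi3 2 = -1) // !mulf_eq0.
move=> /norP[/norP[/norP[/norP[_ n1] n2] n3] n4].
rewrite expr1 in n1 *; field.
by rewrite n1 n2 n3 n4 oner_neq0.
Qed.

Lemma seed_paired_sum (K r : nat) : (r < K)%N -> seed K r = paired_sum K r.
Proof.
have [n] := ubnP r; elim: n r => // n IH [|[|r]] ltrn ltrK.
- by rewrite seed0 ?paired_sum0.
- by rewrite seed1 ?paired_sum1.
- by rewrite seed_rec ?paired_sum_rec // !IH //; lia.
Qed.

(** * Passage to q-binomials and iteration of Bailey's lemma *)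

(* The coefficient of [2r, r-j] after merging j and -j, where
   (1-j|3) = -(j-1|3). *)
Definition merged_coef (j : nat) : F :=
  if j is i.+1 then
    (jacobi3 i.+2)%:~R * q ^+ (i.+1 * i.+2) - (jacobi3 i)%:~R * q ^+ (i * i.+1)
  else 1.

(** Regrouping by symbol: (i+1|3) occurs in the first part of [merged_coef i] and in the second part
    of [merged_coef i.+2]. The last two terms correct for the cutoff. *)
Lemma sum_merged_coef (K : nat) (w : nat -> F) :
  \sum_(j < K.+1) merged_coef j * w j
  = \sum_(i < K.+1) (jacobi3 i.+1)%:~R
      * (q ^+ (i * i.+1) * w i - q ^+ (i.+1 * i.+2) * w i.+2)
    + (jacobi3 K)%:~R * q ^+ (K * K.+1) * w K.+1
    + (jacobi3 K.+1)%:~R * q ^+ (K.+1 * K.+2) * w K.+2.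
Proof.
elim: K => [|K IH].
  by rewrite !big_ord1 /= expr0 (_ : jacobi3 0 = 0) // (_ : jacobi3 1 = 1) //; ring.
by rewrite big_ord_recr [in RHS]big_ord_recr /= IH; ring.
Qed.

(** The q-binomial [2r, r-j]; by its symmetry in j a natural j suffices. *)
Definition central_binom (r j : nat) : F := P (2 * r) * (rfact q r j * (P (r + j))^-1).

Lemma paired_term_binom (r i : nat) :
  paired_term q r i.+1
  = q ^+ (i * i.+1) * central_binom r i
    - q ^+ (i.+1 * i.+2) * central_binom r i.+2.
Proof.
rewrite /paired_term /central_binom /= qpochS -exprS.
rewrite (mulnC i.+1 i) (_ : i.+1 * i.+2 = i * i.+1 + 2 * i.+1)%N ?exprD; last by lia.
rewrite !addnS (qfactV hq (r + i)) (qfactV hq (r + i).+1).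
case: (ltnP r i) => [lt|le].
  by rewrite !rfact_small; [ring | lia ..].
have [k Ek] : exists k, r = (i + k)%N by exists (r - i)%N; lia.
case: k Ek => [|[|k]] Ek.
- rewrite (_ : i = r); last by lia.
  rewrite (@rfactE _ _ 0 r.+1 r.+1) ?(@rfactE _ _ 0 r r) ?rfact_small; try lia.
  rewrite !mul2n -!addnn !(addSn, addnS) !exprS !exprD.
  by ring.
- rewrite (_ : r = i.+1); last by lia.
  rewrite (@rfactE _ _ 1 i.+2 i.+1) ?(@rfactE _ _ 1 i.+1 i) ?rfact_small; try lia.
  rewrite !mul2n -!addnn !(addSn, addnS) !exprS !exprD.
  by ring.
rewrite (_ : r = (i + k).+2); last by lia.
rewrite (@rfactE _ _ k.+2 _ i.+1) ?(@rfactE _ _ k.+2 (i + k).+2 i)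
  ?(@rfactE _ _ k (i + k).+2 i.+2); try lia.
rewrite (qfactV hq k) (qfactV hq k.+1).
rewrite !mul2n -!addnn !(addSn, addnS) !exprS !exprD.
by ring.
Qed.

Lemma seed_binom (K r : nat) : (r < K)%N ->
  seed K r = \sum_(j < K) merged_coef j * central_binom r j.
Proof.
move=> ltrK; rewrite seed_paired_sum //; case: K ltrK => // K ltrK.
rewrite sum_merged_coef /central_binom !(@rfact_small _ _ r); try lia.
rewrite !mul0r !mulr0 !addr0; apply: eq_bigr => i _.
by rewrite paired_term_binom.
Qed.

(** After exchanging the sums, (q)_(2R) cancels and the sum over R for fixed j is
    [qvandermonde_rfact]. *)
Lemma bailey_step (K L : nat) (c : nat -> F) : (L < K)%N ->
  \sum_(R < K) q ^+ (R ^ 2) * P (2 * L) * rfact q L R * (P (2 * R))^-1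
     * (\sum_(j < K) c j * central_binom R j)
  = \sum_(j < K) c j * q ^+ (j ^ 2) * central_binom L j.
Proof.
move=> ltLK.
under eq_bigr do rewrite mulr_sumr.
rewrite exchange_big; apply: eq_bigr => j _ /=.
transitivity (c j * P (2 * L) * (\sum_(R < K) q ^+ (R ^ 2) * rfact q L R
   * (rfact q R j * (P (R + j))^-1))).
  rewrite mulr_sumr; apply: eq_bigr => R _.
  rewrite /central_binom; have := qfact_neq0 hq (2 * R).
  move: (P (2 * R)) (P (R + j))^-1 => x y nz.
  by field.
by rewrite qvandermonde_rfact // /central_binom; ring.
Qed.

(** The left side as nested sums over N_1, ..., N_f: R is the current N_i and the argument L is the
    preceding one, with N_0 = L. *)
Fixpoint chain (K f L : nat) : F :=
  if f is g.+1 then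
    \sum_(R < K) q ^+ (R ^ 2) * P (2 * L) * rfact q L R * (P (2 * R))^-1
      * chain K g R
  else seed K L.

Lemma chainE (K f L : nat) : (L < K)%N ->
  chain K f L = \sum_(j < K) merged_coef j * q ^+ (f * j ^ 2) * central_binom L j.
Proof.
elim: f L => [|f IH] L ltLK /=.
  by rewrite seed_binom //; apply: eq_bigr => j _; rewrite mul0n expr0 mulr1.
under eq_bigr => R _ do rewrite IH //.
rewrite (@bailey_step K L (fun j => merged_coef j * q ^+ (f * j ^ 2))) //.
by apply: eq_bigr => j _; rewrite mulSn exprD; ring.
Qed.

End Seed.

(** * Finitely supported sums, sums over tuples, and tail sums *)

Lemma fsum_inj (V : nmodType) (T : choiceType) (I : finType) (h : I -> T)
    (G : T -> V) : injective h -> (forall x, x \notin codom h -> G x = 0) ->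
  \sum_(x \in [set: T]) G x = \sum_(i : I) G (h i).
Proof.
move=> inj_h G0; rewrite (fsbigE (codom h)) //; last 2 first.
- by rewrite map_inj_uniq ?enum_uniq.
- by move=> x _; apply: G0.
by rewrite big_image_cond /=; apply: eq_bigl => i; rewrite mem_setT.
Qed.

(** Serves to replace n_i by N_i = n_i + c; the range is kept because g lives on c <= R < K. *)
Lemma sum_shift (V : nmodType) (K c : nat) (g : nat -> V) :
    (forall R, (R < c)%N -> g R = 0) -> (forall R, (K <= R)%N -> g R = 0) ->
  \sum_(n < K) g (n + c)%N = \sum_(R < K) g R.
Proof.
move=> g_lo g_hi; transitivity (\sum_(0 <= i < K + c) g i).
  rewrite (@big_cat_nat _ _ _ c) ?leq_addl //= [X in _ = X + _]big_nat.
  rewrite [X in _ = X + _]big1 ?add0r; last first.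
    by move=> i /andP[_ /g_lo].
  by rewrite -[in RHS](add0n c) big_addn add0n addnK big_mkord.
rewrite (@big_cat_nat _ _ _ K) ?leq_addr //= [X in _ + X]big_nat.
rewrite [X in _ + X]big1 ?addr0 ?big_mkord //.
by move=> i /andP[/g_hi].
Qed.

Lemma sum_tupleS (V : nmodType) (T : finType) (n : nat) (G : seq T -> V) :
  \sum_(t : n.+1.-tuple T) G t = \sum_(x : T) \sum_(t : n.-tuple T) G (x :: t).
Proof.
rewrite pair_big /= (reindex (fun p : T * n.-tuple T => cons_tuple p.1 p.2)) //=.
exists (fun t : n.+1.-tuple T => (thead t, behead_tuple t)) => [[x t] _|t _].
  by congr pair; apply: val_inj.
by apply: val_inj; rewrite /= [in RHS](tuple_eta t).
Qed.

(** N_1^2 + ... + N_f^2 by recursion on the list, whose total is N_1. *)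
Fixpoint sqtails (s : seq nat) : nat :=
  if s is _ :: s' then (sumn s ^ 2 + sqtails s')%N else 0%N.

Lemma tailsum_drop (f : nat) (s : f.-tuple nat) (i : nat) :
  tailsum s i.+1 = sumn (drop i s).
Proof.
rewrite /tailsum /part big_add1 /= sumnE [RHS](big_nth 0%N) size_drop size_tuple.
rewrite -{1}[i]add0n [LHS]big_addn; apply: eq_bigr => k _.
by rewrite nth_drop addnC.
Qed.

Lemma sum_sqtails (s : seq nat) :
  (\sum_(0 <= i < size s) sumn (drop i s) ^ 2)%N = sqtails s.
Proof.
elim: s => [|n s IH]; first by rewrite big_nil.
by rewrite big_nat_recl //= -IH.
Qed.

Lemma sqsumE (f : nat) (s : f.-tuple nat) : sqsum s = sqtails s.
Proof.
rewrite /sqsum big_add1 /= -sum_sqtails size_tuple.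
by apply: eq_bigr => i _; rewrite tailsum_drop.
Qed.

Lemma leq_sumn (s : seq nat) (k : nat) : k \in s -> (k <= sumn s)%N.
Proof.
elim: s => // n s IH; rewrite inE => /orP[/eqP->|/IH le] /=; lia.
Qed.

Lemma rqpoch_neg (F : fieldType) (q : F) (n : int) : n < 0 -> rqpoch q n = 0.
Proof. by case: n. Qed.

Lemma double_tri (n : nat) : (2 * tri n = n * n.+1)%N.
Proof. by elim: n => [|n IH] //=; lia. Qed.

(** * Unfolding both sides of the theorem *)

Section Unfolding.
Variables (F : fieldType) (q : F).
Hypothesis hq : forall n : nat, (0 < n)%N -> q ^+ n != 1.

Local Notation P := (qpoch q q).

(* In the theorem n_i = N_i - N_(i+1): the factor 1/(q)_(n_i) appears here as
   rfact N_i N_(i+1) in the next step of the recursion. *)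
Fixpoint chain_term (K L : nat) (s : seq nat) : F :=
  if s is n :: s' then
    q ^+ (sumn s ^ 2) * P (2 * L) * rfact q L (sumn s) * (P (2 * sumn s))^-1
      * chain_term K (sumn s) s'
  else seed q K L.

Lemma chain_term_small (K L : nat) (s : seq nat) :
  (L < sumn s)%N -> chain_term K L s = 0.
Proof. by case: s => // m s lt /=; rewrite rfact_small // !(mulr0, mul0r). Qed.

Lemma sum_chain_term (K f L : nat) : (L < K)%N ->
  \sum_(t : f.-tuple 'I_K) chain_term K L (map val t) = chain q K f L.
Proof.
elim: f L => [|f IH] L ltLK.
  rewrite (big_pred1 [tuple]) // => t; rewrite [t]tuple0; exact/esym/eqP.
rewrite (sum_tupleS f (fun s : seq 'I_K => chain_term K L (map val s))) exchange_big /=.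
under [RHS]eq_bigr => R _ do rewrite -IH // mulr_sumr.
rewrite [RHS]exchange_big /=; apply: eq_bigr => t _.
set c := sumn (map val t).
(* Here c = N_2 and R = N_1. Terms with R < c vanish in the tail, those with R >= K > L through
   1/(q)_(L-R). *)
rewrite -(@sum_shift _ K c (fun R => q ^+ (R ^ 2) * P (2 * L) * rfact q L R
  * (P (2 * R))^-1 * chain_term K R (map val t))) //.
- by move=> R lt; rewrite chain_term_small // mulr0.
- by move=> R le; rewrite rfact_small ?(mulr0, mul0r) //; lia.
Qed.

(** Each 1/(q)_(2N_i) cancels against the numerator of the next level, so only (q)_(2L) and the last
    reciprocal 1/(q)_(2n_f) survive. *)
Lemma chain_termE (K L n : nat) (s : seq nat) :
  chain_term K L (n :: s) = q ^+ sqtails (n :: s) * P (2 * L)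
    * rfact q L (sumn (n :: s))
    * (\prod_(0 <= i < size s) (P (nth 0%N (n :: s) i))^-1)
    * (P (2 * last n s))^-1 * seed q K (last n s).
Proof.
elim: s n L => [|n' s IH] n L; first by rewrite big_nil /= !addn0 mulr1.
rewrite /= -/(chain_term K _ (n' :: s)) IH big_nat_recl //=.
rewrite (@rfactE _ _ n (n + (n' + sumn s))) ?[RHS]exprD; last by lia.
have := qfact_neq0 hq (2 * (n + (n' + sumn s))).
rewrite [q ^+ (_ + (_ + _))]exprD.
move: (P (2 * (n + (n' + sumn s)))) (P n)^-1 (P (2 * last n' s))^-1
  => x y z nz.
move: (\prod_(_ <= _ < _) _) => w.
by field.
Qed.

Lemma chain_term_tuple (K L f : nat) (s : f.+1.-tuple nat) :
  chain_term K L s = q ^+ sqsum s * P (2 * L)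
    * rqpoch q (L%:Z - (tailsum s 1)%:Z)
    * (\prod_(1 <= i < f.+1) rqpoch q (part s i))
    * rqpoch q (2 * part s f.+1)%N * seed q K (part s f.+1).
Proof.
rewrite rqpochB sqsumE tailsum_drop drop0 big_add1 /part /=.
case: s => -[|n s] //= /eqP[<-].
by rewrite -/(chain_term K L (n :: s)) chain_termE (last_nth 0%N).
Qed.

(** With M = 2m+3n the first exponent is 3n(n+1)/2 + M(M+1)/2 plus the squares; the second exceeds
    it by M, and the prefactor q completes (M+1)(M+2)/2. The two summands thus carry u_M and
    u_(M+1). *)
Lemma sum_summands (K L f : nat) (s : f.+1.-tuple nat) :
  \sum_(m < K) \sum_(n < K) (summand1 q L m n s + q * summand2 q L m n s)
  = chain_term K L s.
Proof.
rewrite chain_term_tuple /seed mulr_sumr; apply: eq_bigr => m _.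
rewrite mulr_sumr; apply: eq_bigr => n _.
rewrite /summand1 /summand2 /cube_coef /seed_term -!rqpochB /=.
move: (part s f.+1) (tailsum s 1) => r N.
rewrite (_ : r%:Z - (3 * n)%:Z - (2 * m)%:Z = r%:Z - (2 * m + 3 * n)%N%:Z); last by lia.
rewrite (_ : _ - 1 = r%:Z - (2 * m + 3 * n).+1%:Z); last by lia.
have t0 := double_tri n; have t1 := double_tri (2 * m + 3 * n).
rewrite (_ : 2 * m ^ 2 + 6 * m * n + 6 * n ^ 2 + m + 3 * n + sqsum s
  = 3 * tri n + tri (2 * m + 3 * n) + sqsum s)%N; last by lia.
rewrite (_ : 2 * m ^ 2 + 6 * m * n + 6 * n ^ 2 + 3 * m + 6 * n + sqsum s
  = 3 * tri n + tri (2 * m + 3 * n) + (2 * m + 3 * n) + sqsum s)%N; last by lia.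
move: (2 * m + 3 * n)%N {t1} => M; rewrite !exprD (exprS q M).
by ring.
Qed.

Lemma qbinomE (a b : nat) :
  qbinom q (a + b)%:Z a = P (a + b) / (P a * P b).
Proof. by rewrite /qbinom PoszD addrAC subrr add0r. Qed.

Lemma qbinomB (L i : nat) : (i <= L)%N ->
  qbinom q (2 * L)%:Z (L%:Z - i%:Z) = central_binom q L i.
Proof.
move=> leiL; rewrite /central_binom (@rfactE _ _ (L - i)) ?subnKC // subzn //.
rewrite (_ : 2 * L = L - i + (L + i))%N; last by lia.
by rewrite qbinomE invfM.
Qed.

Lemma qbinomD (L i : nat) : (i <= L)%N ->
  qbinom q (2 * L)%:Z (L%:Z + i%:Z) = central_binom q L i.
Proof.
move=> leiL; rewrite /central_binom (@rfactE _ _ (L - i)) ?subnKC // -PoszD.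
rewrite (_ : 2 * L = L + i + (L - i))%N; last by lia.
by rewrite qbinomE invfM [in LHS](mulrC (P (L + i))^-1).
Qed.

Lemma sum_jacobi3 (L f : nat) :
  \sum_(j \in [set j : int | - L%:Z <= j <= L%:Z])
      (jacobi3 (j + 1))%:~R * q ^ ((f.+1)%:Z * j ^+ 2 + j)
      * qbinom q (2 * L)%:Z (L%:Z - j)
  = \sum_(j < L.+1) merged_coef q j * q ^+ (f * j ^ 2) * central_binom q L j.
Proof.
(* Since [Negz i] is -(i+1), the index j = 0 stands alone and [Posz i.+1] is matched with
   [Negz i]. *)
rewrite (fsbigE ([seq Posz i | i <- iota 0 L.+1] ++ [seq Negz i | i <- iota 0 L])).
- rewrite big_cat /= big_cons !big_map.
  have in_range (j : int) : (j \in [set j : int | - L%:Z <= j <= L%:Z])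
      = (- L%:Z <= j <= L%:Z) by apply/idP/idP; rewrite inE.
  rewrite in_range ifT; last by lia.
  rewrite big_ord_recl -addrA; congr (_ + _).
    rewrite qbinomB //= (_ : jacobi3 _ = 1) // mulr0 addr0 expr0z.
    by rewrite muln0 expr0.
  rewrite (iotaDl 1 0) big_map.
  rewrite -[in iota 0 L](subn0 L) !big_mkord.
  rewrite (eq_bigl xpredT) => [|i]; last by rewrite in_range; have := ltn_ord i; lia.
  rewrite [X in _ + X](eq_bigl xpredT) => [|i]; last first.
    by rewrite in_range NegzE; have := ltn_ord i; lia.
  rewrite -big_split; apply: eq_bigr => i _.
  rewrite add1n qbinomB ?ltn_ord // NegzE opprK qbinomD //=.
  rewrite (_ : - i.+1%:Z + 1 = - i%:Z) ?jacobi3N; last by lia.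
  rewrite (_ : f.+1%:Z * i.+1%:Z ^+ 2 + i.+1%:Z
    = (i.+1 * i.+2 + f * i.+1 ^ 2)%N); last by lia.
  rewrite (_ : f.+1%:Z * (- i.+1%:Z) ^+ 2 - i.+1%:Z
    = (i * i.+1 + f * i.+1 ^ 2)%N); last by lia.
  rewrite -!exprnP !exprD mulrNz (_ : i.+1%:Z + 1 = i.+2) /bump ?add1n; last by lia.
  by ring.
- rewrite cat_uniq !map_inj_uniq ?iota_uniq; try by move=> ? ? [].
  rewrite andbT /=; apply/hasPn => x /mapP[i _ ->]; apply/mapP => -[] //.
- move=> j; rewrite /mkset mem_cat => /orP[] /mapP[i]; rewrite mem_iota => ? ->; lia.
- move=> [i|i]; rewrite /mkset mem_cat negb_or => ? /andP[].
  + by rewrite mem_map ?mem_iota; [lia|move=> ? ? []].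
  + by move=> _; rewrite mem_map ?mem_iota; [lia|move=> ? ? []].
Qed.

End Unfolding.

Theorem theorem23 (F : fieldType) (q : F)
    (hq : forall n : nat, (0 < n)%N -> q ^+ n != 1)
    (L f : nat) (hf : (0 < f)%N) :
  (\sum_(x \in [set: nat * nat * f.-tuple nat])
      summand1 q L x.1.1 x.1.2 x.2)
  + q * (\sum_(x \in [set: nat * nat * f.-tuple nat])
      summand2 q L x.1.1 x.1.2 x.2)
  = \sum_(j \in [set j : int | - L%:Z <= j <= L%:Z])
      (jacobi3 (j + 1))%:~R * q ^ ((f.+1)%:Z * j ^+ 2 + j)
      * qbinom q (2 * L)%:Z (L%:Z - j).
Proof.
(* Nonzero summands have all indices at most L, so L+1 serves as the common cutoff. *)
case: f hf => // f _; pose K := L.+1.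
pose h (x : 'I_K * 'I_K * f.+1.-tuple 'I_K) : nat * nat * f.+1.-tuple nat :=
  (x.1.1 : nat, x.1.2 : nat, map_tuple val x.2).
have inj_h : injective h.
  move=> [[m n] t] [[m' n'] t'] [/val_inj-> /val_inj-> /(inj_map val_inj)] E.
  by congr pair; apply: val_inj.
(* If all three inequalities fail, every n_i is at most N_1 <= L, and 2m, 3n <= n_f <= L, so the
   point lies in the box. Each inequality makes a reciprocal with negative index vanish. *)
have out_h x : x \notin codom h ->
    [\/ (L < tailsum x.2 1)%N, (part x.2 f.+1 < 2 * x.1.1)%N
      | (part x.2 f.+1 < 3 * x.1.2)%N].
  case: x => [[m n] s] /=; rewrite tailsum_drop drop0 => x_out.
  case: (ltnP L) => leL; first exact: Or31.
  case: (ltnP (part s f.+1) (2 * m)) => lem; first exact: Or32.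
  case: (ltnP (part s f.+1) (3 * n)) => len; first exact: Or33.
  have le_entry k : k \in (s : seq nat) -> (k <= L)%N.
    by move=> ks; apply: leq_trans (leq_sumn ks) leL.
  have part_le : (part s f.+1 <= L)%N.
    by apply: le_entry; rewrite mem_nth // size_tuple.
  case/negP: x_out; apply/codomP.
  exists (inord m, inord n, map_tuple inord s); rewrite /h /= !inordK; try lia.
  congr pair; apply: val_inj; rewrite /= -map_comp -[LHS]map_id.
  by apply/eq_in_map => k /le_entry ltkL /=; rewrite inordK.
rewrite !(fsum_inj inj_h); last 2 first.
- move=> [[m n] s] /out_h /= out; rewrite /summand2.
  case: out => lt.
  + by rewrite (@rqpoch_neg _ _ (_ - (tailsum s 1)%:Z)) ?(mulr0, mul0r) //; lia.
  + by rewrite (@rqpoch_neg _ _ (_ - 1)) ?(mulr0, mul0r) //; lia.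
  + by rewrite (@rqpoch_neg _ _ (_ - 1)) ?(mulr0, mul0r) //; lia.
- move=> [[m n] s] /out_h /= out; rewrite /summand1.
  case: out => lt.
  + by rewrite (@rqpoch_neg _ _ (_ - (tailsum s 1)%:Z)) ?(mulr0, mul0r) //; lia.
  + by rewrite (@rqpoch_neg _ _ (_ - (2 * m)%:Z)) ?(mulr0, mul0r) //; lia.
  + by rewrite (@rqpoch_neg _ _ (_ - (2 * m)%:Z)) ?(mulr0, mul0r) //; lia.
rewrite sum_jacobi3 -chainE // -sum_chain_term //.
rewrite mulr_sumr -big_split /=.
(* The sum over the tuple is moved outside, so that the inner sum over m and n is the one in
   [sum_summands]. *)
rewrite -(pair_big xpredT xpredT
  (fun (y : 'I_K * 'I_K) (t : f.+1.-tuple 'I_K) =>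
     summand1 q L y.1 y.2 (map_tuple val t)
     + q * summand2 q L y.1 y.2 (map_tuple val t))) /=.
rewrite exchange_big /=; apply: eq_bigr => t _.
rewrite -[map val t]/(tval (map_tuple val t)) -sum_summands //.
by rewrite pair_big.
Qed.
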